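(* Let $U$ be a banded unitary operator on $\ell^2(\mathbb{Z})$ that has only pure point spectrum and for which all eigenvectors belong to $D(X)$. Then, for every $\psi \in D(X)$, $$\lim_{t\to\infty}\frac{1}{t^2}\,\|XU^t\psi\|^2=0,$$ where $t$ ranges over the positive integers.
   Context: $\{\delta_n\}_{n\in\mathbb{Z}}$ is the standard basis of $\ell^2(\mathbb{Z})$. A unitary operator $U:\ell^2(\mathbb{Z})\to\ell^2(\mathbb{Z})$ is called banded if for some $R>0$ one has $\langle \delta_n, U\delta_m\rangle = 0$ whenever $|n-m|>R$. $U$ has only pure point spectrum if $\ell^2(\mathbb{Z})$ has an orthonormal basis consisting of eigenvectors of $U$. The position operator $X: D(X)\to\ell^2(\mathbb{Z})$ is given by $[X\psi](n)=n\psi(n)$ with domain $D(X)=\{\psi\in\mathbb{C}^{\mathbb{Z}}: \sum_{n\in\mathbb{Z}}|n\psi(n)|^2<\infty\}$. (For a banded unitary $U$, $D(X)$ is $U$-invariant, so $XU^t\psi$ makes sense for $\psi \in D(X)$.) *)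

(* Defs.v *)
From HB Require Import structures.
From mathcomp Require Import all_boot all_order all_algebra.
From mathcomp Require Import ring complex.
From mathcomp Require Import all_classical all_reals all_analysis.
Set Implicit Arguments.
Unset Strict Implicit.
Unset Printing Implicit Defensive.
Import Order.TTheory GRing.Theory Num.Theory.
Import numFieldNormedType.Exports.
Import ComplexField.Normc.

Local Open Scope classical_set_scope.
Local Open Scope ring_scope.

Section SequenceSpace.
Variable R : realType.
Implicit Types (f g : int -> R[i]).

(* The squared l^2(Z)-norm, in [0, +oo]; it is +oo off l^2(Z). *)
Definition l2normsq f : \bar R :=
  (\esum_(n in [set: int]) (normc (f n) ^+ 2)%:E)%E.

Definition is_l2 : {pred int -> R[i]} := [pred f | `[< (l2normsq f < +oo)%E >]].

Lemma is_l2P f : reflect (l2normsq f < +oo)%E (f \in is_l2).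
Proof. exact: asboolP. Qed.

Lemma l2normsq_ge0 f : (0 <= l2normsq f)%E.
Proof. by apply: esum_ge0 => n _; rewrite lee_fin sqr_ge0. Qed.

Lemma l2normsq0 : l2normsq 0 = 0%E.
Proof. by apply: esum1 => n _; rewrite normc0 expr0n. Qed.

Lemma esumZ (c : R) (u : int -> R) : 0 <= c -> (forall n, 0 <= u n) ->
  (\esum_(n in [set: int]) (c * u n)%:E <=
   c%:E * \esum_(n in [set: int]) (u n)%:E)%E.
Proof.
move=> c0 u0; apply: ub_ereal_sup => _ [A [finA _] <-].
under eq_fsbigr do rewrite EFinM.
rewrite -ge0_mule_fsumr; last by move=> n; rewrite lee_fin.
apply: lee_wpmul2l; first by rewrite lee_fin.
by apply: ereal_sup_ubound; exists A.
Qed.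

Lemma l2normsq_lin (a : R[i]) f g :
  (l2normsq (a *: f + g)%R
   <= (2 * normc a ^+ 2)%:E * l2normsq f + 2%:E * l2normsq g)%E.
Proof.
have sq (x : R[i]) : 0 <= normc x ^+ 2 by exact: sqr_ge0.
apply: (@le_trans _ _ (\esum_(n in [set: int])
    ((2 * normc a ^+ 2 * normc (f n) ^+ 2)%:E +
     (2 * normc (g n) ^+ 2)%:E))%E).
  apply: le_esum => n _; rewrite -EFinD lee_fin.
  have le_n : normc ((a *: f + g) n) <= normc a * normc (f n) + normc (g n).
    by rewrite -normcM; exact: le_normcD.
  have norm_ge0 (x : R[i]) : 0 <= normc x by case: x => x y; rewrite sqrtr_ge0.
  apply: (@le_trans _ _ ((normc a * normc (f n) + normc (g n)) ^+ 2)).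
    by rewrite lerXn2r// nnegrE ?addr_ge0 ?mulr_ge0 ?norm_ge0.
  rewrite -mulrA -exprMn -mulrDr -subr_ge0.
  move: (normc a * _) (normc (g n)) => x y.
  suff -> : 2 * (x ^+ 2 + y ^+ 2) - (x + y) ^+ 2 = (x - y) ^+ 2.
    exact: sqr_ge0.
  by ring.
rewrite esumD; first last.
- by move=> n _; rewrite lee_fin mulr_ge0.
- by move=> n _; rewrite lee_fin (mulr_ge0 (mulr_ge0 _ (sq _)) (sq _)).
by apply: leeD; apply: esumZ => //; exact: mulr_ge0 (sq a).
Qed.

Fact is_l2_submod_closed : submod_closed is_l2.
Proof.
split=> [|a f g /is_l2P fl2 /is_l2P gl2]; apply/is_l2P.
  by rewrite l2normsq0 ltry.
apply: le_lt_trans (l2normsq_lin a f g) _.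
apply: lte_add_pinfty; apply: lte_mul_pinfty; rewrite // lee_fin.
exact: mulr_ge0 (sqr_ge0 _).
Qed.

HB.instance Definition _ :=
  GRing.isSubmodClosed.Build R[i] (int -> R[i]) is_l2 is_l2_submod_closed.

(* l^2(Z), as a complex vector space *)
Record ell2 := Ell2 { ell2_val :> int -> R[i]; ell2P : ell2_val \in is_l2 }.
HB.instance Definition _ := [isSub for ell2_val].
HB.instance Definition _ := [Choice of ell2 by <:].
HB.instance Definition _ := [SubChoice_isSubLmodule of ell2 by <:].

(* Unconditional sums over Z: [zsum u] and [czsum f] are the intended values
   when u and f are absolutely summable, and junk otherwise. *)
Definition zsum (u : int -> R) : R :=
  fine (\esum_(n in [set: int]) (EFin \o u)^\+ n -
        \esum_(n in [set: int]) (EFin \o u)^\- n)%E.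

Definition czsum f : R[i] :=
  Complex (zsum (fun n => complex.Re (f n))) (zsum (fun n => complex.Im (f n))).

(* conjugate-linear in the first argument *)
Definition dotz (phi psi : ell2) : R[i] :=
  czsum (fun n => conjc (phi n) * psi n).

Fact delta_subproof (n : int) : (fun m : int => (m == n)%:R : R[i]) \in is_l2.
Proof.
apply/is_l2P; rewrite /l2normsq (esumID [set n])/=; last first.
  by move=> m _; rewrite lee_fin sqr_ge0.
rewrite !setTI esum_set1; last by rewrite lee_fin sqr_ge0.
rewrite esum1 ?adde0 ?ltry// => m /= /eqP/negbTE ->.
by rewrite normc0 expr0n.
Qed.

Definition delta (n : int) : ell2 := Ell2 (delta_subproof n).

Definition unitary (U : {linear ell2 -> ell2}) : Prop :=
  (forall phi psi : ell2, dotz (U phi) (U psi) = dotz phi psi) /\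
  (forall psi : ell2, exists phi : ell2, U phi = psi).

Definition banded (U : {linear ell2 -> ell2}) : Prop :=
  exists2 r : R, 0 < r &
    forall n m : int, r < `|n - m|%:~R -> dotz (delta n) (U (delta m)) = 0.

Definition eigenvector (U : {linear ell2 -> ell2}) (psi : ell2) : Prop :=
  psi != 0 /\ exists lambda : R[i], U psi = lambda *: psi.

Definition orthonormal_set (B : set ell2) : Prop :=
  forall phi psi : ell2, B phi -> B psi -> dotz phi psi = (phi == psi)%:R.

(* The finite linear combinations of elements of B are dense in l^2(Z). *)
Definition total_set (B : set ell2) : Prop :=
  forall (psi : ell2) (eps : R), 0 < eps ->
    exists2 s : seq (R[i] * ell2), (forall p, p \in s -> B p.2) &
      (l2normsq (psi - \sum_(p <- s) p.1 *: p.2 : ell2)%R < eps%:E)%E.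

Definition orthonormal_basis (B : set ell2) : Prop :=
  orthonormal_set B /\ total_set B.

Definition pure_point (U : {linear ell2 -> ell2}) : Prop :=
  exists2 B : set ell2,
    orthonormal_basis B & forall psi, B psi -> eigenvector U psi.

Definition posX f : int -> R[i] := fun n => n%:~R * f n.

Definition domX : set (int -> R[i]) := [set f | (l2normsq (posX f) < +oo)%E].

(* Quantifying over the psi : ell2 with [domX psi] therefore covers all of
   D(X), although [domX] is a set of arbitrary sequences. *)
Lemma domX_is_l2 f : domX f -> f \in is_l2.
Proof.
move=> fX; apply/is_l2P; rewrite /l2normsq (esumID [set 0])/=; last first.
  by move=> m _; rewrite lee_fin sqr_ge0.
rewrite !setTI esum_set1; last by rewrite lee_fin sqr_ge0.
apply: lte_add_pinfty; first exact: ltry.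
apply: le_lt_trans fX; rewrite esum_mkcond; apply: le_esum => n _.
case: ifPn => [|_]; last by rewrite lee_fin sqr_ge0.
rewrite inE/= => /eqP n0; rewrite lee_fin /posX normcM exprMn.
rewrite ler_peMl ?sqr_ge0// -[n%:~R](rmorph_int (real_complex R)) /normc/=.
rewrite expr0n addr0 sqr_sqrtr ?sqr_ge0// -rmorphXn/= ler1z.
by rewrite -gtz0_ge1 exprn_even_gt0.
Qed.

End SequenceSpace.

(* Main.v *)
Require Import Defs.
From HB Require Import structures.
From mathcomp Require Import all_boot all_order all_algebra.
From mathcomp Require Import complex.
From mathcomp Require Import all_classical all_reals all_analysis.
From mathcomp Require Import ring lra zify.

(** Write [X] for the position operator [posX]. Since [U] is an isometry, the
    telescoping identity
      X U^t g = U^t X g + sum_(s < t) U^(t-1-s) (XU - UX) U^s g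
    shows that ||X U^t g|| grows at most linearly, with slope ||XU - UX|| ||g||.
    The commutator is bounded because [U] is banded: its matrix entries are
    those of [U] multiplied by n - m, and this factor is bounded on the band.
    What matters is that the slope involves the l^2-norm of g alone, while
    ||X g|| only enters the constant term.

    On an eigenvector phi, of eigenvalue lambda, one has
    X U^t phi = lambda^t X phi, which stays bounded because phi lies in D(X); so
    t |-> ||X U^t f|| is bounded for every finite combination f of eigenvectors.
    Pure point spectrum gives such an f with g = psi - f small in l^2. Nothing
    is known on the size of ||X g||, but it is finite, so the growth bound gives
    limsup ||X U^t psi|| / t <= ||XU - UX|| ||g||, which is as small as desired.

    The three ingredients are [commutator_bounded], [posX_iter_growth] and
    [posX_iter_eigen_comb_bounded], assembled in [posX_iter_quadratic_bound].
    The estimates are carried out on squared norms, where the triangle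
    inequality is replaced by |x + y|^2 <= (1 + eta) |x|^2 + (1 + 1/eta) |y|^2
    with a weight eta that is chosen anew at each step. *)

Set Implicit Arguments.
Unset Strict Implicit.
Unset Printing Implicit Defensive.
Import Order.TTheory GRing.Theory Num.Theory.
Import numFieldNormedType.Exports.
Import ComplexField.Normc.
Local Open Scope classical_set_scope.
Local Open Scope ring_scope.

(** * The inner product of l^2(Z) and unitaries *)

Lemma normc_ge0 (R : realType) (z : R[i]) : 0 <= normc z.
Proof. by case: z => x y; rewrite sqrtr_ge0. Qed.

Lemma conjc_mul_self (R : realType) (z : R[i]) :
  conjc z * z = Complex (normc z ^+ 2) 0.
Proof.
case: z => x y; rewrite /normc sqr_sqrtr ?addr_ge0 ?sqr_ge0//.
by apply/eqP; rewrite eq_complex/=; apply/andP; split; apply/eqP; ring.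
Qed.

Lemma normc_conj (R : realType) (z : R[i]) : normc (conjc z) = normc z.
Proof. by case: z => x y; rewrite /normc /= sqrrN. Qed.

Lemma normc_int (R : realType) (n : int) : normc (n%:~R : R[i]) = `|n|%:~R.
Proof.
rewrite -[n%:~R](rmorph_int (real_complex R)) /normc/=.
by rewrite expr0n addr0 sqrtr_sqr intr_norm.
Qed.

Lemma esum_finsupp (R : realType) (u : int -> R) (s : seq int) : uniq s ->
  (forall m, 0 <= u m) -> (forall m, m \notin s -> u m = 0) ->
  (\esum_(m in [set: int]) (u m)%:E = (\sum_(m <- s) u m)%:E)%E.
Proof.
move=> us u0 us0.
transitivity (\esum_(m in [set` s]) (u m)%:E)%E.
  rewrite [RHS]esum_mkcond; apply: eq_esum => m _.
  by case: ifPn => //; rewrite notin_setE/= => /negP/us0 ->.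
by rewrite esum_fset//= -?fsbig_seq ?sumEFin// => m _; rewrite lee_fin.
Qed.

Lemma zsum_finsupp (R : realType) (u : int -> R) (s : seq int) : uniq s ->
  (forall m, m \notin s -> u m = 0) -> zsum u = \sum_(m <- s) u m.
Proof.
move=> us us0; rewrite /zsum.
have eP : (EFin \o u)^\+%E = fun n => (Num.max (u n) 0)%:E.
  by apply/funext => n; rewrite funeposE EFin_max.
have eN : (EFin \o u)^\-%E = fun n => (Num.max (- u n) 0)%:E.
  by apply/funext => n; rewrite funenegE EFin_max EFinN.
rewrite eP eN.
have u0 (x : R) : 0 <= Num.max x 0 by rewrite le_max lexx orbT.
rewrite !(@esum_finsupp _ _ s)//=; first last.
- by move=> m /us0 ->; rewrite maxxx.
- by move=> m /us0 ->; rewrite oppr0 maxxx.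
rewrite -sumrB; apply: eq_bigr => m _.
have [um|/ltW um] := leP (u m) 0.
  by rewrite max_l ?oppr_ge0// sub0r opprK.
by rewrite max_r ?oppr_le0// subr0.
Qed.

Lemma czsum_finsupp (R : realType) (f : int -> R[i]) (s : seq int) : uniq s ->
  (forall m, m \notin s -> f m = 0) -> czsum f = \sum_(m <- s) f m.
Proof.
move=> us f0; rewrite /czsum !(@zsum_finsupp _ _ s)//; first last.
- by move=> m /f0 ->.
- by move=> m /f0 ->.
apply/eqP; rewrite eq_complex/=.
rewrite [in X in X && _]raddf_sum/= [in X in _ && X]raddf_sum/=.
by rewrite !eqxx.
Qed.

Lemma dotz_self (R : realType) (phi : ell2 R) :
  dotz phi phi = Complex (fine (l2normsq phi)) 0.
Proof.
rewrite /dotz (_ : (fun _ => _) =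
  fun n => Complex (normc (phi n) ^+ 2) 0); last first.
  by apply/funext => n; exact: conjc_mul_self.
rewrite /czsum /=; congr Complex; last first.
  by rewrite (@zsum_finsupp _ _ [::])// big_nil.
rewrite /zsum [X in (_ - X)%E]esum1; last first.
  by move=> n _; rewrite funenegE /= max_r// lee_fin oppr_le0 sqr_ge0.
rewrite sube0; congr fine; apply: eq_esum => n _.
by rewrite funeposE /= max_l// lee_fin sqr_ge0.
Qed.

Lemma dotz_delta (R : realType) (n : int) (psi : ell2 R) :
  dotz (delta R n) psi = psi n.
Proof.
rewrite /dotz (@czsum_finsupp _ _ [:: n])//=; last first.
  by move=> m; rewrite inE => /negbTE ->; rewrite conjc0 mul0r.
by rewrite big_seq1 eqxx conjc1 mul1r.
Qed.

Lemma dotz_deltar (R : realType) (n : int) (psi : ell2 R) :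
  dotz psi (delta R n) = conjc (psi n).
Proof.
rewrite /dotz (@czsum_finsupp _ _ [:: n])//=; last first.
  by move=> m; rewrite inE => /negbTE ->; rewrite mulr0.
by rewrite big_seq1 eqxx mulr1.
Qed.

Lemma l2normsq_fin_num (R : realType) (phi : ell2 R) :
  l2normsq phi \is a fin_num.
Proof. by rewrite ge0_fin_numE ?l2normsq_ge0//; apply/is_l2P; exact: ell2P. Qed.

Lemma unitary_l2normsq (R : realType) (U : {linear ell2 R -> ell2 R})
  (phi : ell2 R) : unitary U -> l2normsq (U phi) = l2normsq phi.
Proof.
case=> isoU _; have := isoU phi phi; rewrite !dotz_self => -[].
by move=> e; rewrite -[LHS]fineK ?l2normsq_fin_num// e fineK ?l2normsq_fin_num.
Qed.

Lemma normc_le_l2normsq (R : realType) (f : int -> R[i]) (n : int) :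
  ((normc (f n) ^+ 2)%:E <= l2normsq f)%E.
Proof.
rewrite /l2normsq (esumID [set n])/=; last first.
  by move=> m _; rewrite lee_fin sqr_ge0.
rewrite !setTI esum_set1; last by rewrite lee_fin sqr_ge0.
by rewrite leeDl// esum_ge0// => m _; rewrite lee_fin sqr_ge0.
Qed.

Lemma l2normsq_delta (R : realType) (n : int) : l2normsq (delta R n) = 1%E.
Proof.
rewrite /l2normsq (@esum_finsupp _ _ [:: n])//=.
- by rewrite big_seq1 eqxx normc1 expr1n.
- by move=> m; rewrite sqr_ge0.
- by move=> m; rewrite inE => /negbTE ->; rewrite normc0 expr0n.
Qed.

(** * Estimates on squared norms *)

(** Young's inequality 2xy <= eta x^2 + y^2/eta, in a form whose first
    coefficient can be taken arbitrarily close to 1; this is what keeps the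
    growth of iterated sums polynomial. *)
Lemma l2normsq_add_le (R : realType) (f g : int -> R[i]) (eta a b : R) :
  0 < eta ->
  (l2normsq f <= a%:E)%E -> (l2normsq g <= b%:E)%E ->
  (l2normsq (f + g)%R <= ((1 + eta) * a + (1 + eta^-1) * b)%:E)%E.
Proof.
move=> eta0 fa gb; have ei0 : 0 < eta^-1 by rewrite invr_gt0.
apply: (@le_trans _ _ (\esum_(n in [set: int])
    (((1 + eta) * normc (f n) ^+ 2)%:E + ((1 + eta^-1) * normc (g n) ^+ 2)%:E))%E).
  apply: le_esum => n _; rewrite -EFinD lee_fin.
  apply: (@le_trans _ _ ((normc (f n) + normc (g n)) ^+ 2)).
    by rewrite lerXn2r ?nnegrE ?addr_ge0 ?normc_ge0//; exact: le_normcD.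
  rewrite -subr_ge0; move: (normc (f n)) (normc (g n)) => x y.
  have -> : (1 + eta) * x ^+ 2 + (1 + eta^-1) * y ^+ 2 - (x + y) ^+ 2 =
    eta * (x - eta^-1 * y) ^+ 2 by field; rewrite gt_eqF.
  by rewrite mulr_ge0 ?sqr_ge0// ltW.
rewrite esumD; first last.
- by move=> n _; rewrite lee_fin mulr_ge0 ?sqr_ge0// addr_ge0 ?ltW.
- by move=> n _; rewrite lee_fin mulr_ge0 ?sqr_ge0// addr_ge0 ?ltW.
rewrite EFinD; apply: leeD; rewrite EFinM.
- apply: le_trans (esumZ _ _) _ => [|n|]; rewrite ?sqr_ge0 ?addr_ge0 ?(ltW eta0)//.
  by rewrite lee_wpmul2l// lee_fin addr_ge0 ?ltW.
- apply: le_trans (esumZ _ _) _ => [|n|]; rewrite ?sqr_ge0 ?addr_ge0 ?(ltW ei0)//.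
  by rewrite lee_wpmul2l// lee_fin addr_ge0 ?ltW.
Qed.

Lemma l2normsq_mul_le (R : realType) (c f : int -> R[i]) (k a : R) :
  (forall n, normc (c n) <= k) -> (l2normsq f <= a%:E)%E ->
  (l2normsq (fun n => c n * f n)%R <= (k ^+ 2 * a)%:E)%E.
Proof.
move=> ck fa; have k0 : 0 <= k by apply: le_trans (ck 0); exact: normc_ge0.
apply: (@le_trans _ _ (\esum_(n in [set: int]) (k ^+ 2 * normc (f n) ^+ 2)%:E)%E).
  apply: le_esum => n _; rewrite lee_fin normcM exprMn ler_wpM2r ?sqr_ge0//.
  by rewrite lerXn2r ?nnegrE ?normc_ge0.
rewrite EFinM; apply: le_trans (esumZ _ _) _ => [|n|]; rewrite ?sqr_ge0//.
by rewrite lee_wpmul2l// lee_fin sqr_ge0.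
Qed.

Lemma l2normsq_shift (R : realType) (f : int -> R[i]) (d : int) :
  l2normsq (fun n => f (n + d)) = l2normsq f.
Proof.
rewrite /l2normsq.
rewrite [RHS](@reindex_esum _ _ _ [set: int] [set: int] (fun n => n + d))//.
split=> //; first by move=> x y _ _; exact: addIr.
by move=> y _; exists (y - d) => //; rewrite subrK.
Qed.

(** If each F_(s+1) is, up to an error of squared norm at most D, no larger
    than F_s, then ||F_s|| <= sqrt A + s sqrt D by the triangle inequality; the
    bound below is the square of this one, relaxed by the Cauchy-Schwarz
    inequality (a + s d)^2 <= (1 + s) (a^2 + s d^2). The comparison sequence G
    stands for the image of F_s under a contraction. *)
Lemma l2normsq_telescope_le (R : realType) (F G : nat -> int -> R[i]) (A D : R) :
  (l2normsq (F 0%N) <= A%:E)%E ->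
  (forall s, l2normsq (G s) <= l2normsq (F s))%E ->
  (forall s, l2normsq (F s.+1 - G s)%R <= D%:E)%E ->
  forall s, (l2normsq (F s) <= (s.+1%:R * (A + s%:R * D))%:E)%E.
Proof.
move=> F0 GF FG; elim=> [|s IH]; first by rewrite mul1r mul0r addr0.
rewrite -[F s.+1](subrK (G s)) addrC.
have s0 : 0 < s.+1%:R :> R by rewrite ltr0n.
(* The weight 1/(s+1) turns the induction hypothesis into the next bound
   without loss, as 1 + 1/(s+1) = (s+2)/(s+1). *)
have := @l2normsq_add_le _ _ _ s.+1%:R^-1 _ _ _ (le_trans (GF s) IH) (FG s).
rewrite invr_gt0 => /(_ s0) /le_trans; apply; rewrite lee_fin le_eqVlt.
apply/orP; left; apply/eqP.
by rewrite -[s.+2%:R]natr1 -[s.+1%:R]natr1; field; rewrite natr1 gt_eqF.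
Qed.

Lemma l2normsq_sum_le (R : realType) (f : nat -> int -> R[i]) (b : R) (k : nat) :
  (forall i, l2normsq (f i) <= b%:E)%E ->
  (l2normsq (\sum_(i < k) f i)%R <= (k.+1%:R * (k%:R * b))%:E)%E.
Proof.
move=> fb; rewrite -[k%:R * b]add0r.
apply: (@l2normsq_telescope_le _ (fun s => \sum_(i < s) f i)
  (fun s => \sum_(i < s) f i)) => //.
- by rewrite big_ord0 l2normsq0.
- by move=> s; rewrite big_ord_recr/= addrAC subrr add0r.
Qed.

(** * Banded unitaries and the position operator *)

(** Row n of the matrix of [U] is read off from the preimage phi_n of delta n
    under [U]: (U g)(n) = <delta n, U g> = <phi_n, g>. The band condition says
    that phi_n has finite support, so this inner product is a finite sum and no
    continuity of [U] has to be invoked; the entries are bounded by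
    ||phi_n|| = 1. The index i stands for the column n + (i - N). *)
Lemma banded_kernel (R : realType) (U : {linear ell2 R -> ell2 R}) :
  unitary U -> banded U ->
  exists (N : nat) (c : int -> nat -> R[i]),
    (forall n i, normc (c n i) <= 1) /\
    forall (g : ell2 R) n,
      U g n = \sum_(i < N.*2.+1) c n i * g (n + (i%:Z - N%:Z)).
Proof.
move=> unU [r r0 bU]; have [isoU surU] := unU.
have /choice[phi phiE] : forall n, exists p : ell2 R, U p = delta R n.
  by move=> n; exact: surU.
pose N := (Num.truncn r).+1.
have phi0 n m : (N < `|n - m|)%N -> phi n m = 0.
  move=> Nnm; apply: (can_inj (@conjcK R)); rewrite -dotz_deltar -isoU phiE conjc0.
  apply: bU; apply: (@lt_le_trans _ _ N%:R); first exact: truncnS_gt.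
  by rewrite -[X in _ <= X]natr_absz ler_nat ltnW.
exists N, (fun n i => conjc (phi n (n + (i%:Z - N%:Z)))); split=> [n i|g n].
  have := normc_le_l2normsq (phi n) (n + (i%:Z - N%:Z)).
  rewrite -(unitary_l2normsq _ unU) phiE l2normsq_delta lee_fin normc_conj.
  by rewrite -[X in _ <= X](expr1n _ 2) ler_pXn2r ?nnegrE ?normc_ge0.
rewrite -dotz_delta -phiE isoU.
rewrite /dotz (@czsum_finsupp _ _ [seq n + (i%:Z - N%:Z) | i <- iota 0 N.*2.+1]).
- by rewrite big_map -/(index_iota 0 N.*2.+1) big_mkord.
- by rewrite map_inj_uniq ?iota_uniq// => i j /=; lia.
- move=> m mN; rewrite phi0 ?conjc0 ?mul0r//.
  rewrite ltnNge; apply: contra mN => mN; apply/mapP.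
  by exists (absz (m - n + N%:Z)%R); first rewrite mem_iota; lia.
Qed.

Lemma l2normsq_add_le2 (R : realType) (f g : int -> R[i]) (a b : R) :
  (l2normsq f <= a%:E)%E -> (l2normsq g <= b%:E)%E ->
  (l2normsq (f + g)%R <= (2 * a + 2 * b)%:E)%E.
Proof. by move=> fa gb; have := l2normsq_add_le ltr01 fa gb; rewrite invr1. Qed.

Lemma ell2_valD (R : realType) (f g : ell2 R) :
  (f + g : ell2 R) = f + g :> (int -> R[i]).
Proof. by []. Qed.

Lemma ell2_valZ (R : realType) (a : R[i]) (f : ell2 R) :
  (a *: f : ell2 R) = a *: (f : int -> R[i]) :> (int -> R[i]).
Proof. by []. Qed.

Lemma posXD (R : realType) (f g : int -> R[i]) :
  posX (f + g) = posX f + posX g.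
Proof. by apply/funext => n; rewrite /posX/= mulrDr. Qed.

Lemma posXZ (R : realType) (a : R[i]) (f : int -> R[i]) :
  posX (a *: f) = a *: posX f.
Proof. by apply/funext => n; rewrite /posX/= mulrCA. Qed.

Lemma iter_linearD (K : pzRingType) (V : lmodType K) (U : {linear V -> V}) t f g :
  iter t U (f + g) = iter t U f + iter t U g.
Proof. by elim: t => //= t ->; rewrite linearD. Qed.

Lemma iter_linearZ (K : pzRingType) (V : lmodType K) (U : {linear V -> V}) t a f :
  iter t U (a *: f) = a *: iter t U f.
Proof. by elim: t => //= t ->; rewrite linearZ. Qed.

Lemma iter_linear0 (K : pzRingType) (V : lmodType K) (U : {linear V -> V}) t :
  iter t U 0 = 0.
Proof. by elim: t => //= t ->; rewrite linear0. Qed.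

Lemma l2normsq_lty_real (R : realType) (f : int -> R[i]) : (l2normsq f < +oo)%E ->
  exists2 a : R, 0 <= a & l2normsq f = a%:E.
Proof.
move=> fl2; exists (fine (l2normsq f)); first by rewrite fine_ge0 ?l2normsq_ge0.
by rewrite fineK// ge0_fin_numE ?l2normsq_ge0.
Qed.

(** The commutator is a sum over the 2N + 1 diagonals of the band of a bounded
    multiplier, of size at most N, composed with a shift. As [posX g] is only
    a sequence, the vector xg stands for X g seen in l^2(Z). *)
Lemma commutator_bounded (R : realType) (U : {linear ell2 R -> ell2 R}) :
  unitary U -> banded U ->
  exists2 C : R, 0 <= C & forall (g xg : ell2 R) (a : R),
    xg = posX g :> (int -> R[i]) -> (l2normsq g <= a%:E)%E ->
    (l2normsq (posX (U g) - U xg)%R <= (C * a)%:E)%E.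
Proof.
move=> unU bU; have [N [c [c1 UE]]] := banded_kernel unU bU.
pose k := N.*2.+1; exists (k.+1%:R * (k%:R * N%:R ^+ 2)).
  by rewrite !mulr_ge0// sqr_ge0.
move=> g xg a xgE ga.
pose d (i : nat) : int := N%:Z - i%:Z.
pose F (i : 'I_k) n : R[i] := ((d i)%:~R * c n i) * g (n + (i%:Z - N%:Z)).
(* [inord] sends the indices beyond the band back into it, so that the bound on
   the terms holds for every natural number i. *)
have -> : posX (U g) - U xg = \sum_(i < k) F (inord i).
  apply/funext => n; rewrite [LHS]/= fct_sumE /posX.
  have -> : (posX (U g) - U xg) n = n%:~R * U g n - U xg n by [].
  rewrite !UE mulr_sumr -sumrB; apply: eq_bigr => i _.
  by rewrite inord_val /F xgE /posX /d !(rmorphD, rmorphN, rmorphB)/=; ring.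
rewrite -mulrA -[k%:R * _ * a]mulrA.
apply: (@l2normsq_sum_le _ (fun i => F (inord i))) => i.
move: (inord i : 'I_k) => {}i.
apply: (@l2normsq_mul_le _ (fun n => (d i)%:~R * c n i)); last first.
  by rewrite l2normsq_shift.
move=> n; rewrite normcM normc_int -[N%:R]mulr1.
apply: ler_pM; rewrite ?normc_ge0// ?ler0z//.
by rewrite -[X in _ <= X]/(N%:Z%:~R) ler_int /d; have := ltn_ord i; rewrite /k; lia.
Qed.

(** This is the ballistic upper bound: a controls ||g||^2, A controls ||X g||^2
    and only the former is multiplied by t^2. *)
Lemma posX_iter_growth (R : realType) (U : {linear ell2 R -> ell2 R}) :
  unitary U -> banded U ->
  exists2 C : R, 0 <= C & forall (g : ell2 R) (A a : R) (t : nat),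
    (l2normsq (posX g) <= A%:E)%E -> (l2normsq g <= a%:E)%E ->
    (l2normsq (posX (iter t U g)) <= (t.+1%:R * (A + t%:R * (C * a)))%:E)%E.
Proof.
move=> unU bU; have [C C0 comm] := commutator_bounded unU bU.
exists C => // g A a t gA ga.
have isoU s : l2normsq (iter s U g) = l2normsq g.
  by elim: s => //= s <-; rewrite unitary_l2normsq.
(* D(X) is invariant under U because the commutator is bounded. *)
have dom s : domX (iter s U g).
  elim: s => [|s IH]; first exact: le_lt_trans gA (ltry _).
  pose xg := Ell2 (introT (is_l2P _) IH).
  have [b b0 xgb] := l2normsq_lty_real IH.
  rewrite /domX/= -[posX _](subrK (U xg : int -> R[i])).
  apply: (@le_lt_trans _ _ _%:E); last exact: ltry.
  apply: (@l2normsq_add_le2 _ _ _ (C * a) b) => //.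
    by apply: comm; rewrite ?isoU.
  by rewrite unitary_l2normsq// xgb.
have /choice[xg xgE] : forall s, exists x : ell2 R,
    x = posX (iter s U g) :> (int -> R[i]).
  by move=> s; exists (Ell2 (introT (is_l2P _) (dom s))).
apply: (@l2normsq_telescope_le _ (fun s => posX (iter s U g))
  (fun s => U (xg s))) => // s.
  by rewrite unitary_l2normsq// xgE.
by apply: comm; rewrite ?isoU.
Qed.

(** Applying the isometry property to phi = lambda^-1 U phi is enough, because
    an upper bound for the powers of lambda is all that is needed. *)
Lemma unitary_eigenvalue_normc_le1 (R : realType) (U : {linear ell2 R -> ell2 R})
  (phi : ell2 R) (lambda : R[i]) :
  unitary U -> phi != 0 -> U phi = lambda *: phi -> normc lambda <= 1.
Proof.
move=> unU phi0 Uphi; rewrite leNgt; apply/negP => lam1.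
have nlam0 : normc lambda != 0 by rewrite gt_eqF// (lt_trans _ lam1).
have lam0 : lambda != 0 by apply: contraNneq nlam0 => ->; rewrite normc0.
have [L L0 phiL] : exists2 L : R, 0 <= L & l2normsq phi = L%:E.
  by apply: l2normsq_lty_real; apply/is_l2P; exact: ell2P.
have [n phin] : exists n, phi n != 0.
  apply: contrapT => /forallNP phin; move/eqP: phi0; apply; apply: val_inj.
  by apply/funext => n; apply/eqP; move/negP: (phin n); rewrite negbK.
have Lgt0 : 0 < L.
  rewrite -lte_fin -phiL; apply: lt_le_trans (normc_le_l2normsq phi n).
  rewrite lte_fin exprn_gt0// lt_neqAle normc_ge0 andbT eq_sym.
  by apply: contra phin => /eqP/eq0_normc ->.
have phiE : phi = (fun n => lambda^-1 * (U phi) n) :> (int -> R[i]).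
  by apply/funext => m; rewrite Uphi ell2_valZ mulrA mulVf// mul1r.
have : (l2normsq phi <= ((normc lambda^-1) ^+ 2 * L)%:E)%E.
  rewrite [X in (l2normsq X <= _)%E]phiE; apply: l2normsq_mul_le => //.
  by rewrite unitary_l2normsq// phiL.
rewrite phiL lee_fin normcV leNgt => /negP; apply.
rewrite gtr_pMl// exprn_ilt1 ?invr_ge0 ?normc_ge0//.
by rewrite invf_lt1// (lt_trans _ lam1).
Qed.

(** No uniformity in the combination is claimed: the bound K may blow up as the
    combination approximates a given vector. *)
Lemma posX_iter_eigen_comb_bounded (R : realType) (U : {linear ell2 R -> ell2 R})
  (s : seq (R[i] * ell2 R)) :
  unitary U -> (forall p, p \in s -> eigenvector U p.2 /\ domX p.2) ->
  exists2 K : R, 0 <= K & forall t : nat,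
    (l2normsq (posX (iter t U (\sum_(p <- s) p.1 *: p.2)%R)) <= K%:E)%E.
Proof.
move=> unU; elim: s => [|[a phi] s IH] sP.
  exists 0 => // t; rewrite big_nil iter_linear0.
  by rewrite (_ : posX _ = 0) ?l2normsq0//; apply/funext => n; rewrite /posX mulr0.
have [K K0 KP] : exists2 K : R, 0 <= K & forall t : nat,
    (l2normsq (posX (iter t U (\sum_(p <- s) p.1 *: p.2)%R)) <= K%:E)%E.
  by apply: IH => p ps; apply: sP; rewrite inE ps orbT.
have [[phi0 [lambda Uphi]] phiX] : eigenvector U phi /\ domX phi.
  by apply: (sP (a, phi)); rewrite mem_head.
have lam1 := unitary_eigenvalue_normc_le1 unU phi0 Uphi.
have [L L0 phiL] := l2normsq_lty_real phiX.
have UtE t : iter t U phi = lambda ^+ t *: phi.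
  elim: t => [|t IHt]; first by rewrite expr0 scale1r.
  by rewrite iterS IHt linearZ/= Uphi scalerA exprSr.
exists (2 * (normc a ^+ 2 * L) + 2 * K).
  by rewrite addr_ge0 ?mulr_ge0 ?normc_ge0.
move=> t; rewrite big_cons iter_linearD iter_linearZ UtE ell2_valD posXD scalerA.
apply: l2normsq_add_le2; last exact: KP.
rewrite [X in posX X]ell2_valZ posXZ.
apply: l2normsq_mul_le; last by rewrite phiL.
move=> _; rewrite normcM -[leRHS]mulr1 ler_wpM2l ?normc_ge0//.
elim: t => [|t IHt]; first by rewrite expr0 normc1.
by rewrite exprS normcM mulr_ile1 ?normc_ge0.
Qed.

(** * The absence of ballistic motion *)

(** Writing psi = f + g with f a combination of eigenvectors, eps absorbs the
    quadratic growth of g, and K collects all the rest. The bound is taken at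
    t + 1 so that constants can be absorbed into multiples of it. *)
Lemma posX_iter_quadratic_bound (R : realType) (U : {linear ell2 R -> ell2 R}) :
  unitary U -> banded U -> pure_point U ->
  (forall phi : ell2 R, eigenvector U phi -> domX phi) ->
  forall (psi : ell2 R) (eps : R), domX psi -> 0 < eps ->
  exists2 K : R, 0 <= K & forall t : nat,
    (l2normsq (posX (iter t.+1 U psi)) <= (t.+1%:R * (K + t.+1%:R * eps))%:E)%E.
Proof.
move=> unU bU [B [_ totB] eigB] eigX psi eps psiX eps0.
have [C C0 growth] := posX_iter_growth unU bU.
(* The growth bound is doubled by splitting psi, and doubled once more by
   x + 1 <= 2 x for x = t + 1: hence the factor 4. *)
pose a := eps / 4 / (C + 1).
have C1 : 0 < C + 1 by lra.
have a0 : 0 < a by rewrite !divr_gt0.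
have [s sB sa] := totB psi a a0.
set f := \sum_(p <- s) p.1 *: p.2 in sa.
have [K K0 KP] : exists2 K : R, 0 <= K & forall t : nat,
    (l2normsq (posX (iter t U f)) <= K%:E)%E.
  apply: posX_iter_eigen_comb_bounded => // p ps.
  by split; [|apply: eigX]; apply/eigB/sB.
have [P P0 psiP] := l2normsq_lty_real psiX.
pose A := 2 * P + 2 * K.
have A0 : 0 <= A by rewrite addr_ge0 ?mulr_ge0.
have gA : (l2normsq (posX (psi - f : ell2 R)%R) <= A%:E)%E.
  have -> : posX (psi - f : ell2 R) = posX psi + (fun n => -1 * posX f n).
    apply/funext => n; rewrite [RHS]/(posX psi n + -1 * posX f n) mulN1r.
    by rewrite /posX [LHS]mulrBr.
  apply: l2normsq_add_le2 => //; first by rewrite psiP.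
  have := @l2normsq_mul_le _ (fun=> -1) (posX f) 1 K; rewrite expr1n mul1r; apply.
    by move=> _; rewrite normcN normc1.
  exact: (KP 0%N).
exists (4 * A + 2 * K) => [|t]; first by lra.
rewrite -[psi](subrK f) iter_linearD ell2_valD posXD.
apply: le_trans
  (l2normsq_add_le2 (growth _ _ _ t.+1 gA (ltW sa)) (KP _)) _.
rewrite lee_fin.
have Ca : C * a <= eps / 4.
  by rewrite /a mulrA ler_pdivrMr// mulrC ler_wpM2l//; lra.
have t1 : 1 <= t.+1%:R :> R by rewrite ler1n.
rewrite -[t.+2%:R]natr1; move: (t.+1%:R) (C * a) t1 Ca => x y x1 yle.
have h1 : (x + 1) * (x * y) <= (x + 1) * (x * (eps / 4)).
  by rewrite ler_wpM2l ?ler_wpM2l//; lra.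
have h2 : 0 <= x * (x - 1) * eps.
  by rewrite !mulr_ge0 ?(ltW eps0) ?subr_ge0//; lra.
have h3 : 0 <= (x - 1) * A by rewrite mulr_ge0// subr_ge0.
have h4 : 0 <= (x - 1) * K by rewrite mulr_ge0// subr_ge0.
by move: A h3 {A0 gA} => A h3; lra.
Qed.

Theorem theorem1p1 (R : realType) (U : {linear ell2 R -> ell2 R})
  (U_unitary : unitary U) (U_banded : banded U) (U_pp : pure_point U)
  (eig_domX : forall phi : ell2 R, eigenvector U phi -> domX phi)
  (psi : ell2 R) (psi_domX : domX psi) :
  ((t%:R ^- 2)%:E * l2normsq (posX (iter t U psi)))%E @[t --> \oo] --> 0%E.
Proof.
have split := posX_iter_quadratic_bound U_unitary U_banded U_pp eig_domX psi_domX.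
have fin t : (0 < t)%N -> l2normsq (posX (iter t U psi)) \is a fin_num.
  case: t => // t _; rewrite ge0_fin_numE ?l2normsq_ge0//.
  by have [K _ /(_ t) /le_lt_trans ->] := split 1 ltr01; rewrite ?ltry.
apply: cvg_EFin.
  by near=> t; rewrite fin_numM// fin//; near: t; exists 1%N.
apply/cvgr0Pnorm_le => eps eps0.
have eps2 : 0 < eps / 2 by lra.
have [K K0 KP] := split _ eps2.
near=> t.
have t0 : (0 < t)%N by near: t; exists 1%N.
(* With quadratic coefficient eps / 2, the bound K / t + eps / 2 is at most
   eps from here on. *)
have Kt : 2 * K / eps <= t%:R by near: t; exact: nbhs_infty_ger.
have t1 : 0 < t%:R :> R by rewrite ltr0n.
have := KP t.-1; rewrite prednK//= fineM ?fin//=.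
rewrite -[l2normsq _](fineK (fin t t0)) lee_fin.
have : 0 <= fine (l2normsq (posX (iter t U psi))) by rewrite fine_ge0 ?l2normsq_ge0.
move: (fine _) => y y0 yle.
rewrite ger0_norm; last by rewrite mulr_ge0// invr_ge0 exprn_ge0.
rewrite mulrC ler_pdivrMr ?exprn_gt0//; apply: le_trans yle _.
move: Kt; rewrite ler_pdivrMr//; move: (t%:R) t1 => x x0 h; nra.
Unshelve. all: by end_near.
Qed.
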